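(* Let $q$ be a prime power, let $2\le e\le 6$, let $r$ be a positive integer, let $a\in\mathbb{F}_{q^e}$ with $a\neq 0$, let $f(x)=x^r(x^{q-1}+a)\in\mathbb{F}_{q^e}[x]$, and let $\ell=q^{e-1}+\cdots+q+1$. (i) If $e\in\{2,3,4\}$, then $f(x)$ permutes $\mathbb{F}_{q^e}$ if and only if $(-a)^{\ell}\neq 1$, $\gcd(r,q-1)=1$, and $r \bmod \ell\in\{1,\ell-q\}$. (ii) If $e=5$ and $q$ is an odd prime, then $f(x)$ permutes $\mathbb{F}_{q^5}$ if and only if $(-a)^{\ell}\neq 1$, $\gcd(r,q-1)=1$, and $r\bmod \ell\in\{1,\ell-q,q^3+1,q^4+q^2+1\}$. (iii) If $e=6$ and $q$ is an odd prime, then $f(x)$ permutes $\mathbb{F}_{q^6}$ if and only if $(-a)^{\ell}\neq 1$, $\gcd(r,q-1)=1$, and $r\bmod \ell\in\{1,\ell-q\}$.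
   Context: A polynomial permutes $\mathbb{F}_{q^e}$ if the map $x\mapsto f(x)$ is a bijection of $\mathbb{F}_{q^e}$. For integers $r$ and $\ell\ge 1$, $r\bmod \ell$ denotes the least nonnegative residue of $r$ modulo $\ell$. *)

(* Defs.v *)
From mathcomp Require Import all_boot all_order all_algebra all_field.
Set Implicit Arguments. Unset Strict Implicit. Unset Printing Implicit Defensive.
Import GRing.Theory.
Local Open Scope ring_scope.

Definition prime_power (q : nat) : Prop := exists p k : nat, prime p /\ (0 < k)%N /\ q = (p ^ k)%N.

Definition ell (q e : nat) : nat := (\sum_(i < e) q ^ i)%N.

Definition permutes_f (F : finFieldType) (q r : nat) (a : F) : Prop :=
  bijective (fun x : F => x ^+ r * (x ^+ (q - 1) + a)).

(* Main.v *)
Require Import Defs.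
From mathcomp Require Import all_boot all_order all_algebra all_field cyclic.
From mathcomp Require Import zify ring.
Import GRing.Theory.
Local Open Scope ring_scope.

(** Sufficiency. For each listed residue [r] there is [m] with [r * ell q m = 1] modulo
    [ell q e], so that [q ^ m * r = r + q - 1] modulo [q ^ e - 1]. If [f x = f y] and
    [A = x ^+ r - y ^+ r], this turns [f x = f y] into [A ^+ (q ^ m) = - a * A]; a nonzero
    [A] would give [- a] the norm 1, and [A = 0] forces [x = y].

    Necessity. By Hermite's criterion, for [0 < N < ell q e] the sum of
    ['C((q - 1) * N, j) * a ^- j] over the [j] with [ell q e %| r * N + j] vanishes, so exactly
    one of these binomials cannot be nonzero modulo the characteristic. Lucas' theorem shows
    where they are nonzero. Taking [N = ell q (e - 1)] gives [r = 1 + q * T]; replacing [j] by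
    [(q - 1) * N - j] exchanges [T] with [ell q (e - 1) - 1 - T]; a few more choices of [N] leave
    only the listed residues. When [d] divides [e], multiples of [ell (q ^ d) (e / d)] reduce the
    problem to degree [d], as needed for [e = 4] and [e = 6]. A single case, [q] even and
    [T] at the middle of its range, needs a sum with two nonzero terms. *)

(** * Binomial coefficients in positive characteristic *)

Lemma coef_1DXn (R : comNzRingType) (n i : nat) :
  ((1 + 'X) ^+ n : {poly R})`_i = 'C(n, i)%:R.
Proof.
rewrite exprDn coef_sum.
under eq_bigr => j _ do rewrite expr1n mul1r coefMn coefXn.
have [lt_in|le_ni] := ltnP i n.+1.
  rewrite (bigD1 (Ordinal lt_in)) //= eqxx big1 ?addr0 // => j neq_ji.
  by rewrite -[i]/(nat_of_ord (Ordinal lt_in)) eq_sym (inj_eq val_inj) (negPf neq_ji) mul0rn.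
rewrite bin_small // big1 // => j _.
by rewrite gtn_eqF ?mul0rn // (leq_trans (ltn_ord j)).
Qed.

(** Compare coefficients in [(1 + 'X) ^+ n * (1 + 'X ^+ Q)], raising to the power [Q] being
    additive. *)
Lemma bin_addl_pchar (R : comNzRingType) (Q n i : nat) :
  [pchar R].-nat Q -> (0 < Q)%N ->
  'C(n + Q, i)%:R = 'C(n, i)%:R + (if (i < Q)%N then 0 else 'C(n, i - Q)%:R) :> R.
Proof.
move=> pQ Q0; rewrite -!coef_1DXn exprD [X in _ * X]exprDn_pchar; last first.
  by rewrite (eq_pnat _ (pchar_poly R)).
by rewrite expr1n mulrDr mulr1 coefD coefMXn.
Qed.

(** Each factor [1 + 'X ^+ Q] peeled off acts as Pascal's rule on [(b, d)]. As [b] and [d] are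
    unbounded, iteration splits off one base-[Q] digit at a time. *)
Lemma lucas_pchar (R : comNzRingType) (Q a b c d : nat) :
  [pchar R].-nat Q -> (a < Q)%N -> (c < Q)%N ->
  'C(a + b * Q, c + d * Q)%:R = 'C(a, c)%:R * 'C(b, d)%:R :> R.
Proof.
move=> pQ ltaQ ltcQ; have Q0 := leq_ltn_trans (leq0n a) ltaQ.
elim: b d => [|b IHb] [|d].
- by rewrite !mul0n !addn0 bin0 mulr1.
- by rewrite mul0n addn0 bin0n mulr0 bin_small //; nia.
- by rewrite mulSn addnCA addnC bin_addl_pchar // mul0n addn0 ltcQ addr0
    -{1}[c]addn0 -[X in (c + X)%N](mul0n Q) IHb !bin0.
rewrite mulSn addnCA addnC bin_addl_pchar // ifF; last by nia.
have -> : (c + d.+1 * Q - Q = c + d * Q)%N by nia.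
by rewrite !IHb binS natrD mulrDr.
Qed.

(** Row [Q] vanishes strictly between its ends, so neighbours in row [Q - 1] are opposite. *)
Lemma bin_pred_pchar (R : comNzRingType) (Q i : nat) :
  [pchar R].-nat Q -> (i < Q)%N -> 'C(Q - 1, i)%:R = (-1) ^+ i :> R.
Proof.
move=> pQ; have [->|Q0] := posnP Q; first by [].
elim: i => [|i IHi] ltiQ; first by rewrite bin0.
have := bin_addl_pchar _ Q 0 i.+1 pQ Q0.
rewrite ltiQ bin0n addr0 add0n -[in 'C(Q, _)](subnK Q0) addn1 binS natrD.
by rewrite IHi 1?ltnW // exprS => /(canRL (addrK _)); rewrite sub0r mulN1r.
Qed.

Lemma bin_pred2_pchar (R : comNzRingType) (Q i : nat) :
  [pchar R].-nat Q -> (1 < Q)%N -> (i < Q)%N ->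
  'C(Q - 2, i)%:R = (-1) ^+ i * i.+1%:R :> R.
Proof.
move=> pQ Q1; elim: i => [|i IHi] ltiQ; first by rewrite bin0 mulr1.
have := bin_pred_pchar R Q i.+1 pQ ltiQ.
have -> : (Q - 1 = (Q - 2).+1)%N by lia.
rewrite binS natrD IHi 1?ltnW // => /(canRL (addrK _)) ->.
by rewrite exprS -[i.+2]addn1 natrD; ring.
Qed.

(** * Repunits, power sums and Hermite's criterion *)

Lemma ell0 q : ell q 0 = 0%N.
Proof. exact: big_ord0. Qed.

Lemma ellS q e : ell q e.+1 = (1 + q * ell q e)%N.
Proof.
rewrite /ell big_ord_recl expn0 big_distrr; congr (_ + _)%N.
by apply: eq_bigr => i _; rewrite lift0 expnS.
Qed.

Lemma ellSr q e : ell q e.+1 = (ell q e + q ^ e)%N.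
Proof. exact: big_ord_recr. Qed.

Lemma ell_gt0 q e : (0 < e)%N -> (0 < ell q e)%N.
Proof. by case: e => // e _; rewrite ellS. Qed.

Lemma mul_pred_ell q e : ((q - 1) * ell q e = q ^ e - 1)%N.
Proof. by rewrite subn1 -predn_exp subn1. Qed.

Lemma ell_ltX q e : (1 < q)%N -> (ell q e < q ^ e)%N.
Proof. by move=> q1; have := mul_pred_ell q e; have : (0 < q ^ e)%N by [rewrite expn_gt0; lia]; nia. Qed.

Lemma ellM q d e : (1 < q)%N -> ell q (e * d) = (ell q e * ell (q ^ e) d)%N.
Proof.
move=> q1; have q1' : (0 < q - 1)%N by rewrite subn_gt0.
apply/eqP; rewrite -(eqn_pmul2l q1') mulnA !mul_pred_ell.
by rewrite -expnM.
Qed.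

Lemma finField_prim_root (F : finFieldType) :
  {g : F | (#|F| - 1).-primitive_root g}.
Proof.
have F1 := finNzRing_gt1 F.
have /hasP/sig2W[g _ prim_g] : has (#|F| - 1).-primitive_root (enum (predC1 (0 : F))).
  apply: has_prim_root; rewrite ?subn_gt0 ?enum_uniq //.
    apply/allP => x; rewrite mem_enum inE => x0; rewrite unity_rootE.
    by rewrite -(inj_eq (mulfI x0)) -exprS subn1 prednK ?expf_card ?mulr1 // ltnW.
  by rewrite -cardE cardC1 subn1.
by exists g.
Qed.

(** Substituting [g * x] for [x], with [g] a generator, multiplies the sum by [g ^+ m], which is 1
    only if [#|F| - 1] divides [m]. *)
Lemma sum_finField_expr (F : finFieldType) (m : nat) : (0 < m)%N ->
  \sum_(x : F) x ^+ m = if (#|F| - 1 %| m)%N then -1 else 0.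
Proof.
move=> m0; have [g prim_g] := finField_prim_root F.
have F1 := finNzRing_gt1 F.
have g0 : g != 0.
  apply: contra_eq_neq (prim_expr_order prim_g) => ->.
  by rewrite expr0n subn_eq0 leqNgt F1 eq_sym oner_neq0.
case: ifP => [dvd_m|ndvd_m].
  rewrite (bigD1 0) //= expr0n gtn_eqF // add0r.
  rewrite (eq_bigr (fun=> 1)) => [|x x0]; last first.
    have [u ->] := dvdnP dvd_m; rewrite mulnC exprM.
    suff -> : x ^+ (#|F| - 1) = 1 by rewrite expr1n.
    by apply: (mulfI x0); rewrite -exprS subn1 prednK ?expf_card ?mulr1 // ltnW.
  (* It remains to see that [#|F|] vanishes in [F]: the shift by 1 permutes the field, so adding 1
     to every summand does not change the total. *)
  rewrite sumr_const cardC1; apply/eqP; rewrite -subr_eq0 opprK -mulrSr.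
  rewrite prednK 1?ltnW //; have /eqP : \sum_(x : F) (x + 1) = \sum_(x : F) x.
    by rewrite [RHS](reindex_inj (addIr 1)).
  by rewrite big_split /= sumr_const -[X in _ == X]addr0 (inj_eq (addrI _)).
suff : (g ^+ m - 1) * \sum_x x ^+ m = 0.
  move/eqP; rewrite mulf_eq0 subr_eq0 -(prim_order_dvd prim_g) ndvd_m /=.
  by move/eqP.
rewrite mulrBl mul1r mulr_sumr [X in _ - X](reindex_inj (mulfI g0)).
by under [X in _ - X]eq_bigr => x _ do rewrite exprMn; rewrite subrr.
Qed.

(* Hermite's power sums of order [(q - 1) * N], with [c = a^-1] and the constant factor dropped. *)
Definition hermite_sums (F : fieldType) (q e r : nat) (c : F) : Prop :=
  forall N, (0 < N < ell q e)%N ->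
  \sum_(j < ((q - 1) * N).+1 | (ell q e %| r * N + j)%N)
     'C((q - 1) * N, j)%:R * c ^+ j = 0.

(** By bijectivity the values raised to the power [M] have the same sum as [x ^+ M], which is 0
    since [0 < M < #|F| - 1]. In the expansion, [j] carries [x ^+ ((q - 1) * (r * N + j))], whose
    sum survives exactly when [ell q e] divides [r * N + j]. *)
Lemma permutes_hermite (F : finFieldType) (q e r : nat) (a : F) :
  (1 < q)%N -> #|F| = (q ^ e)%N -> (0 < r)%N -> a != 0 ->
  permutes_f q r a -> hermite_sums F q e r a^-1.
Proof.
move=> q1 oF r0 a0 /bij_inj f_inj N /andP[N0 ltN]; set M := ((q - 1) * N)%N.
have M0 : (0 < M)%N by rewrite muln_gt0 subn_gt0 q1.
have oF1 : (#|F| - 1 = (q - 1) * ell q e)%N by rewrite oF mul_pred_ell.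
have ndvd_M : (#|F| - 1 %| M)%N = false.
  by rewrite oF1 dvdn_pmul2l ?subn_gt0 // gtnNdvd.
have := sum_finField_expr F M M0; rewrite ndvd_M (reindex_inj f_inj) /=.
have expand x : (x ^+ r * (x ^+ (q - 1) + a)) ^+ M
    = \sum_(j < M.+1) 'C(M, j)%:R * a ^+ (M - j) * x ^+ ((q - 1) * (r * N + j)).
  rewrite exprMn -exprM addrC exprDn big_distrr /=; apply: eq_bigr => j _.
  rewrite -mulr_natl -exprM mulrCA -!mulrA; congr (_ * _).
  by rewrite mulrCA -exprD mulnDr /M mulnCA.
under eq_bigr => x _ do rewrite expand.
rewrite exchange_big /=.
under eq_bigr => j _ do
  rewrite -mulr_sumr sum_finField_expr ?muln_gt0 ?subn_gt0 ?q1 ?addn_gt0 ?muln_gt0 ?r0 ?N0 //.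
rewrite oF1 => sum0.
have /eqP : - a ^+ M * \sum_(j < M.+1 | (ell q e %| r * N + j)%N) 'C(M, j)%:R * a^-1 ^+ j = 0.
  rewrite -[RHS]sum0 mulr_sumr big_mkcond /=; apply: eq_bigr => j _.
  rewrite dvdn_pmul2l ?subn_gt0 //; case: ifP => _; last by rewrite mulr0.
  rewrite mulrN1 mulNr mulrCA exprVn -expfB_cond ?(negPf a0) //.
  by rewrite add0n -ltnS.
by rewrite mulf_eq0 oppr_eq0 expf_eq0 (negPf a0) andbF => /eqP.
Qed.

(** What the vanishing sums retain once [c] is forgotten: a condition on the characteristic and on
    [r] modulo [ell q e]. *)
Definition no_lone_term (R : comNzRingType) (q e r : nat) : Prop :=
  forall N j, (0 < N < ell q e)%N -> (j <= (q - 1) * N)%N ->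
    (ell q e %| r * N + j)%N ->
    (forall i, (i <= (q - 1) * N)%N -> (ell q e %| r * N + i)%N -> i != j ->
       'C((q - 1) * N, i)%:R = 0 :> R) ->
    'C((q - 1) * N, j)%:R = 0 :> R.

Lemma hermite_no_lone_term (F : fieldType) (q e r : nat) (c : F) :
  c != 0 -> hermite_sums F q e r c -> no_lone_term F q e r.
Proof.
move=> c0 H N j ltN lejM dvdj others; have := H N ltN.
rewrite (bigD1 (inord j)) /= inordK ?ltnS // big1 => [|i /andP[dvdi neq_ij]].
  by rewrite addr0 => /eqP; rewrite mulf_eq0 expf_eq0 (negPf c0) andbF orbF => /eqP.
rewrite others ?mul0r //; first by rewrite -ltnS.
by apply: contraNneq neq_ij => <-; rewrite inord_val.
Qed.

Lemma dvdn_modMDl (l r s N i : nat) :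
  r = s %[mod l] -> (l %| r * N + i)%N = (l %| s * N + i)%N.
Proof. by move=> eq_rs; rewrite /dvdn -modnDml -modnMml eq_rs modnMml modnDml. Qed.

Lemma no_lone_term_modn (R : comNzRingType) (q e r s : nat) :
  r = s %[mod ell q e] -> no_lone_term R q e r -> no_lone_term R q e s.
Proof.
move=> eq_rs S N j; have dvdE i := dvdn_modMDl _ r s N i eq_rs.
move=> ltN lejM; rewrite -dvdE => dvdj others; apply: S => // i lei dvdi.
by apply: others => //; rewrite -dvdE.
Qed.

(** The map [i |-> M - i] preserves the binomials of row [M = (q - 1) * N] and swaps the two
    progressions, since [(r * N + (M - i)) + (s * N + i) = (r + s + q - 1) * N]. *)
Lemma no_lone_term_dual (R : comNzRingType) (q e r s : nat) :
  (0 < q)%N -> (ell q e %| r + s + q - 1)%N ->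
  no_lone_term R q e r -> no_lone_term R q e s.
Proof.
move=> q0 dvd_rs S N j ltN lejM; set M := ((q - 1) * N)%N in lejM *.
have dvdE i : (i <= M)%N -> (ell q e %| s * N + i)%N = (ell q e %| r * N + (M - i))%N.
  move=> leiM; have : (ell q e %| (r * N + (M - i)) + (s * N + i))%N.
    have -> : (r * N + (M - i) + (s * N + i) = (r + s + q - 1) * N)%N.
      by rewrite -addnBA // !mulnDl -/M; lia.
    exact: dvdn_mulr.
  by move=> d; apply/idP/idP => d'; [rewrite -(dvdn_addl _ d') | rewrite -(dvdn_addr _ d')].
move=> + others; rewrite dvdE // => dvdj; rewrite -bin_sub //.
apply: S => // [|i leiM dvdi neq_i]; first exact: leq_subr.
rewrite -bin_sub //; apply: others; rewrite ?leq_subr //.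
  by rewrite dvdE ?leq_subr // subKn.
by apply: contraNneq neq_i => <-; rewrite subKn.
Qed.

(** * Direct consequences of bijectivity, and sufficiency *)

(** An element [z] of order [gcdn r (q - 1)] takes the same value as 1, so its order is 1. *)
Lemma permutes_coprime (F : finFieldType) (q e r : nat) (a : F) :
  (1 < q)%N -> (0 < e)%N -> #|F| = (q ^ e)%N -> permutes_f q r a -> coprime r (q - 1).
Proof.
move=> q1 e0 oF /bij_inj f_inj; have [g prim_g] := finField_prim_root F.
set d := gcdn r (q - 1); have q10 : (0 < q - 1)%N by rewrite subn_gt0.
have dvd_dF : (d %| #|F| - 1)%N.
  by rewrite oF -mul_pred_ell dvdn_mulr // dvdn_gcdr.
pose z := g ^+ ((#|F| - 1) %/ d).
have zd : z ^+ d = 1 by rewrite -exprM divnK // (prim_expr_order prim_g).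
have z_exp m : (d %| m)%N -> z ^+ m = 1.
  by move/dvdnP=> [k ->]; rewrite mulnC exprM zd expr1n.
have /f_inj/eqP : z ^+ r * (z ^+ (q - 1) + a) = 1 ^+ r * (1 ^+ (q - 1) + a).
  by rewrite !expr1n !z_exp ?dvdn_gcdl ?dvdn_gcdr.
rewrite -(prim_order_dvd prim_g) /coprime -/d => dvd.
have F1 : (0 < #|F| - 1)%N by rewrite subn_gt0 finNzRing_gt1.
have d0 : (0 < d)%N by rewrite gcdn_gt0 q10 orbT.
have := dvdn_leq _ dvd; rewrite divn_gt0 // => /(_ (dvdn_leq F1 dvd_dF)).
by have := divnK dvd_dF; nia.
Qed.

(** Norm 1 makes [- a] a [(q - 1)]-th power [(g ^+ k) ^+ (q - 1)]; then [g ^+ k] is a second root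
    besides 0. *)
Lemma permutes_norm_neq1 (F : finFieldType) (q e r : nat) (a : F) :
  (1 < q)%N -> (0 < e)%N -> #|F| = (q ^ e)%N -> (0 < r)%N ->
  permutes_f q r a -> (- a) ^+ ell q e != 1.
Proof.
move=> q1 e0 oF r0 /bij_inj f_inj; apply/negP => /eqP norm1.
have [g prim_g] := finField_prim_root F.
have l0 := ell_gt0 q e e0; have q10 : (0 < q - 1)%N by rewrite subn_gt0.
have oF1 : (#|F| - 1 = (q - 1) * ell q e)%N by rewrite oF mul_pred_ell.
have : (- a) ^+ (#|F| - 1) = 1 by rewrite oF1 mulnC exprM norm1 expr1n.
move/(prim_rootP prim_g) => [[i /= _] ai].
have : (q - 1 %| i)%N.
  by rewrite -(dvdn_pmul2r l0) -oF1 (prim_order_dvd prim_g) exprM -ai norm1.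
move=> /dvdnP[k ik]; have g0 : g != 0.
  apply: contra_eq_neq (prim_expr_order prim_g) => ->.
  by rewrite oF1 expr0n muln_eq0 !gtn_eqF // eq_sym oner_neq0.
have /f_inj/eqP : (g ^+ k) ^+ r * ((g ^+ k) ^+ (q - 1) + a) = 0 ^+ r * (0 ^+ (q - 1) + a).
  by rewrite -[_ ^+ (q - 1)]exprM -ik -ai addNr mulr0 expr0n gtn_eqF // mul0r.
by rewrite expf_eq0 (negPf g0) andbF.
Qed.

(* The exponent [r + q - 1] is [q ^ m * r] modulo [#|F| - 1], so for [A = x ^+ r - y ^+ r]
   the equality of the values at [x] and [y] reads [A ^+ (q ^ m) = - a * A]. *)
Lemma inverse_ell_permutes (F : finFieldType) (q e r m : nat) (a : F) :
  (1 < q)%N -> (0 < e)%N -> #|F| = (q ^ e)%N -> [pchar F].-nat q -> (0 < r)%N ->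
  (- a) ^+ ell q e != 1 -> coprime r (q - 1) ->
  (0 < m)%N -> r * ell q m = 1 %[mod ell q e] -> permutes_f q r a.
Proof.
move=> q1 e0 oF pq r0 norm cop m0 inv; apply: injF_bij => x y.
have l0 := ell_gt0 q e e0; have q10 : (0 < q - 1)%N by rewrite subn_gt0.
have lm0 := ell_gt0 q m m0.
have oF1 : (#|F| - 1 = (q - 1) * ell q e)%N by rewrite oF mul_pred_ell.
have F1 := finNzRing_gt1 F.
have expF1 z : z != 0 -> z ^+ (#|F| - 1) = 1 :> F.
  by move=> z0; apply: (mulfI z0); rewrite -exprS subn1 prednK ?expf_card ?mulr1 // ltnW.
have [t rlm] : exists t, (r * ell q m = t * ell q e + 1)%N.
  move/eqP: inv; rewrite eqn_mod_dvd ?muln_gt0 ?r0 // => /dvdnP[t rlm].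
  by exists t; rewrite -rlm subnK // muln_gt0 r0.
have frob z : z ^+ r ^+ (q ^ m) = z ^+ (r + (q - 1)) :> F.
  have [->|z0] := eqVneq z 0.
    by rewrite !expr0n !gtn_eqF ?addn_gt0 ?r0 // expr0n expn_eq0 gtn_eqF // ltnW.
  have -> : (q ^ m = (q - 1) * ell q m + 1)%N by rewrite mul_pred_ell subnK // expn_gt0 ltnW.
  have e1 : (r * ((q - 1) * ell q m + 1) = r + (q - 1) + (#|F| - 1) * t)%N.
    by rewrite oF1; nia.
  by rewrite -exprM e1 exprD [z ^+ (_ * t)]exprM expF1 // expr1n mulr1.
pose A := x ^+ r - y ^+ r => fxy.
have A_frob : A ^+ (q ^ m) = - a * A.
  have -> : A ^+ (q ^ m) = (x ^+ r) ^+ (q ^ m) - (y ^+ r) ^+ (q ^ m).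
    have frobB u v : (u - v) ^+ (q ^ m) = u ^+ (q ^ m) - v ^+ (q ^ m) :> F.
      by apply/esym/(canLR (addrK _)); rewrite -exprDn_pchar ?subrK // pnatX pq.
    exact: frobB.
  (* The zero on the right is replaced by the difference of the two equal values, after which the
     identity is formal. *)
  rewrite !frob !exprD; apply/eqP; rewrite -subr_eq0 -(subr0 0) -{1}(subrr (x ^+ r * (x ^+ (q - 1) + a))).
  by rewrite {2}fxy /A; apply/eqP; ring.
have A0 : A = 0.
  (* As [q ^ m - 1 = (q - 1) * ell q m], the norm of [- a] is a power of [A ^+ (#|F| - 1) = 1]. *)
  apply/eqP; apply: contraR norm => A0; have A1 : - a = A ^+ (q ^ m - 1).
    apply: (mulIf A0); rewrite -A_frob -exprSr subn1 prednK // expn_gt0.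
    by rewrite ltnW.
  by rewrite A1 -exprM -mul_pred_ell mulnAC -oF1 exprM expF1 // expr1n.
have [x0|x0] := eqVneq x 0.
  move/eqP: A0; rewrite /A x0 expr0n gtn_eqF // sub0r oppr_eq0 expf_eq0 r0.
  by move/eqP.
have y0 : y != 0.
  apply: contra_neq x0 => y0; move/eqP: A0.
  by rewrite /A y0 expr0n gtn_eqF // subr0 expf_eq0 r0 => /eqP.
have xyr : (x / y) ^+ r = 1.
  by rewrite expr_div_n -(subrK (y ^+ r) (x ^+ r)) -/A A0 add0r divff // expf_neq0.
have [g prim_g] := finField_prim_root F.
have [i xy_g] := prim_rootP prim_g (expF1 _ (mulf_neq0 x0 (invr_neq0 y0))).
(* By [rlm], a common divisor of [r] and [ell q e] divides 1. With [cop], [r] is prime to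
   [#|F| - 1], so [x / y] is 1. *)
have cop_l : coprime (ell q e) r.
  by apply/eqP/eqP; rewrite -dvdn1 -(dvdn_addr _ (dvdn_mull t (dvdn_gcdl _ _))) -rlm dvdn_mulr // dvdn_gcdr.
have cop_n : coprime (#|F| - 1) r by rewrite oF1 coprimeMl coprime_sym cop.
move/eqP: xyr; rewrite xy_g -exprM -(prim_order_dvd prim_g) Gauss_dvdl //.
rewrite (prim_order_dvd prim_g) -xy_g => /eqP/(congr1 ( *%R^~ y)).
by rewrite mul1r divfK.
Qed.

(** * Residues excluded by a lone term *)

Lemma leq_ell q i e : (i <= e)%N -> (ell q i <= ell q e)%N.
Proof. by move/subnK <-; elim: (e - i)%N => // n IHn; rewrite addSn ellSr (leq_trans IHn) ?leq_addr. Qed.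

(** Terms are spaced by [ell q e]; here [j] has no predecessor at that distance, and its successor
    exceeds [(q - 1) * N]. *)
Lemma lone_term_eq0 (R : comNzRingType) (q e r N j : nat) :
  no_lone_term R q e r -> (0 < N < ell q e)%N -> (j <= (q - 1) * N)%N ->
  ((q - 1) * N < j + ell q e)%N -> (j < ell q e)%N ->
  (ell q e %| r * N + j)%N -> 'C((q - 1) * N, j)%:R = 0 :> R.
Proof.
move=> S ltN lejM ltM ltj dvdj; apply: S => // i leiM dvdi neq_ij.
have [lt_ij|le_ji] := ltnP i j.
  have : (ell q e %| j - i)%N by rewrite -(subnDl (r * N)) dvdn_sub.
  by move/dvdn_leq; rewrite subn_gt0 => /(_ lt_ij); lia.
have : (ell q e %| i - j)%N by rewrite -(subnDl (r * N)) dvdn_sub.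
move/dvdn_leq; rewrite subn_gt0 ltn_neqAle eq_sym neq_ij => /(_ le_ji).
by lia.
Qed.

(** In base [Q], the number [n * ell Q d] has [d] digits, all equal to [n]. *)
Lemma bin_mul_ell (R : comNzRingType) (Q d n i : nat) :
  [pchar R].-nat Q -> (n < Q)%N -> (i < Q)%N ->
  'C(n * ell Q d, i * ell Q d)%:R = 'C(n, i)%:R ^+ d :> R.
Proof.
move=> pQ ltnQ ltiQ; elim: d => [|d IHd]; first by rewrite ell0 !muln0.
have mulE m : (m * ell Q d.+1 = m + m * ell Q d * Q)%N by rewrite ellS; ring.
by rewrite !mulE lucas_pchar // IHd exprS.
Qed.

(** Replace [N] by [N * B]. Since [ell q (e * d) = ell q e * B], terms occur only at multiples of
    [B], and their binomials are the [d]-th powers of those in degree [e]. *)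
Lemma no_lone_term_dvd (F : fieldType) (q e d r : nat) :
  (1 < q)%N -> [pchar F].-nat q -> (0 < d)%N ->
  no_lone_term F q (e * d) r -> no_lone_term F q e r.
Proof.
move=> q1 pq d0 S N j /andP[N0 ltN] lejM dvdj others.
set B := ell (q ^ e) d; have B0 : (0 < B)%N by apply: ell_gt0.
have ltM : ((q - 1) * N < q ^ e)%N.
  have := mul_pred_ell q e; have : (0 < q ^ e)%N by rewrite expn_gt0 ltnW.
  by nia.
have binE i : (i <= (q - 1) * N)%N ->
    'C((q - 1) * (N * B), i * B)%:R = 'C((q - 1) * N, i)%:R ^+ d :> F.
  move=> lei; rewrite mulnA bin_mul_ell ?pnatX ?pq //.
  exact: leq_ltn_trans ltM.
suff /eqP : 'C((q - 1) * (N * B), j * B)%:R = 0 :> F.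
  by rewrite binE // expf_eq0 d0 => /eqP.
have dvdE i : (ell q (e * d) %| r * (N * B) + i * B)%N = (ell q e %| r * N + i)%N.
  by rewrite ellM // mulnA -mulnDl dvdn_pmul2r.
apply: S; rewrite ?dvdE //.
- by rewrite muln_gt0 N0 B0 ellM // ltn_pmul2r.
- by rewrite mulnA leq_pmul2r.
move=> i lei dvdi neq_i; have : (B %| i)%N.
  rewrite -(dvdn_addr _ (dvdn_mull (r * N) (dvdnn B))) -mulnA.
  by apply: dvdn_trans dvdi; rewrite ellM // dvdn_mull.
move=> /dvdnP[k ik]; move: lei dvdi neq_i; rewrite ik mulnA leq_pmul2r // dvdE => lek dvdk neq_k.
rewrite -mulnA binE // others //; first by rewrite expr0n gtn_eqF.
by apply: contraNneq neq_k => ->.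
Qed.

(** For [N = ell q i] the row is [q ^ i - 1], all of whose entries are 1 or -1. *)
Lemma no_lone_term_repunit (F : fieldType) (q e i r j : nat) :
  (1 < q)%N -> [pchar F].-nat q -> no_lone_term F q e r -> (0 < i < e)%N ->
  (j < q ^ i)%N -> ~~ (ell q e %| r * ell q i + j)%N.
Proof.
move=> q1 pq S /andP[i0 ltie] ltj; apply/negP => dvdj.
have M_E := mul_pred_ell q i; have li0 := ell_gt0 q i i0.
have := leq_ell q i.+1 e ltie; rewrite ellSr => le_ell.
have := lone_term_eq0 F q e r (ell q i) j S.
rewrite M_E bin_pred_pchar ?pnatX ?pq //.
move=> /(_ _ _ _ _ dvdj)/eqP; rewrite signr_eq0 => H.
by have : false by apply: H; lia.
Qed.

(** Since [ell q e + q ^ e = l], [r * ell q e + s] is divisible by [l], so the repunit [N = ell q e]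
    forces [q ^ e <= s]. Multiplying [s] by [q] recovers [r], because [q ^ e.+1] is 1 modulo [l]. *)
Lemma no_lone_term_residue (F : fieldType) (q e r : nat) :
  (1 < q)%N -> [pchar F].-nat q -> (0 < e)%N -> no_lone_term F q e.+1 r ->
  exists2 T, (T < ell q e)%N & r = 1 + q * T %[mod ell q e.+1].
Proof.
move=> q1 pq e0 S; set l := ell q e.+1; set s := (r * q ^ e %% l)%N.
have l0 : (0 < l)%N by apply: ell_gt0.
have lE : l = (ell q e + q ^ e)%N by apply: ellSr.
have les : (q ^ e <= s)%N.
  rewrite leqNgt; apply/negP => lts.
  have /negP[] : ~~ (l %| r * ell q e + s)%N.
    by apply: (no_lone_term_repunit F) => //; rewrite e0 ltnSn.
  by rewrite /dvdn modnDmr -mulnDr -lE modnMl.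
exists (s - q ^ e)%N; first by have := ltn_pmod (r * q ^ e) l0; rewrite -/s; lia.
have Xq : (q ^ e.+1 = (q - 1) * l + 1)%N.
  by rewrite mul_pred_ell subnK // expn_gt0 ltnW.
have -> : r = r * q ^ e.+1 %[mod l].
  by rewrite Xq mulnDr mulnA -modnDml modnMl muln1.
rewrite -[RHS](modnMDl (q - 1)) addnA -Xq expnS -mulnDr subnKC //.
by rewrite /s modnMmr mulnCA mulnA.
Qed.

Lemma no_lone_term_flip (R : comNzRingType) (q e T U : nat) :
  (0 < q)%N -> (T + U + 1 = ell q e)%N ->
  no_lone_term R q e.+1 (1 + q * T) -> no_lone_term R q e.+1 (1 + q * U).
Proof.
move=> q0 TU; apply: no_lone_term_dual => //.
have -> : (1 + q * T + (1 + q * U) + q - 1 = ell q e.+1)%N; last exact: dvdnn.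
by rewrite ellS -TU; nia.
Qed.

Lemma natr_ell (R : comNzRingType) (q e : nat) :
  q%:R = 0 :> R -> (0 < e)%N -> (ell q e)%:R = 1 :> R.
Proof. by case: e => // e q0 _; rewrite ellS natrD natrM q0 mul0r addr0. Qed.

(* The exponent is [N = 2 * ell q e]; the binomial that survives is [2 * T] up to sign. *)
Lemma no_lone_term_double (F : fieldType) (q e T : nat) :
  (1 < q)%N -> [pchar F].-nat q -> q%:R = 0 :> F -> (0 < e)%N -> (2 * T < ell q e)%N ->
  no_lone_term F q e.+1 (1 + q * T) -> (2 * T)%:R = 0 :> F.
Proof.
move=> q1 pq qF e0 ltT S; set Q := (q ^ e)%N.
have Q1 : (1 < Q)%N by rewrite -(expn0 q) ltn_exp2l.
have ltlQ : (ell q e < Q)%N by apply: ell_ltX.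
have lE : ell q e.+1 = (ell q e + Q)%N by apply: ellSr.
have l0 := ell_gt0 q e e0.
pose j := (Q - ell q e + 2 * T)%N; have ltjQ : (j < Q)%N by rewrite /j; lia.
have M_E : ((q - 1) * (2 * ell q e) = Q - 2 + 1 * Q)%N.
  by rewrite mulnCA mul_pred_ell -/Q; lia.
have := lone_term_eq0 F q e.+1 (1 + q * T) (2 * ell q e) j S.
have -> : 'C((q - 1) * (2 * ell q e), j)%:R = 'C((q - 1) * (2 * ell q e), j + 0 * Q)%:R :> F.
  by rewrite mul0n addn0.
rewrite M_E lucas_pchar ?pnatX ?pq //; last by lia.
rewrite bin0 mulr1 bin_pred2_pchar ?pnatX ?pq //.
have -> : j.+1%:R = (2 * T)%:R :> F.
  rewrite /j -addn1 !natrD natrB 1?ltnW // natr_ell // natrX qF expr0n gtn_eqF //.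
  by rewrite sub0r addrAC addNr add0r.
move=> H; have /eqP : (-1) ^+ j * (2 * T)%:R = 0 :> F.
  apply: H; rewrite ?lE; try lia.
  apply/dvdnP; exists (1 + 2 * T)%N; rewrite -lE ellS /j.
  have : (ell q e + Q = 1 + q * ell q e)%N by rewrite -lE ellS.
  by nia.
by rewrite mulf_eq0 signr_eq0 => /eqP.
Qed.

(** Either [T] or its mirror image [U] lies in the lower half; if [U] vanishes in [F], so does [T],
    as [T + U + 1 = ell q e] is 1 there. *)
Lemma no_lone_term_odd (F : fieldType) (q e T : nat) :
  (1 < q)%N -> [pchar F].-nat q -> q%:R = 0 :> F -> 2%:R != 0 :> F ->
  (0 < e)%N -> (T < ell q e)%N ->
  no_lone_term F q e.+1 (1 + q * T) -> T%:R = 0 :> F.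
Proof.
move=> q1 pq qF two0 e0 ltT S.
have half U : (2 * U)%:R = 0 :> F -> U%:R = 0 :> F.
  by move/eqP; rewrite natrM mulf_eq0 (negPf two0) => /eqP.
have [lt2T|le2T] := ltnP (2 * T) (ell q e).
  exact/half/(no_lone_term_double F q e).
pose U := (ell q e - 1 - T)%N; have TU : (T + U + 1 = ell q e)%N by rewrite /U; lia.
have U0 : U%:R = 0 :> F.
  apply/half/(no_lone_term_double F q e) => //; first by lia.
  by apply: no_lone_term_flip S => //; rewrite ltnW.
have := natr_ell F q e qF e0; rewrite -TU !natrD U0 addr0 => /(canRL (addrK _)).
by rewrite subrr.
Qed.

(** * Degrees 3 and 4 *)

Lemma ellSS q n : ell q n.+2 = (ell q n + q ^ n + q * q ^ n)%N.
Proof. by rewrite !ellSr expnS. Qed.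

(** The row has low block [W - 1], then base-[q] digits [q - 2] and 1; the leading digit contributes
    the factor 1 for either [b]. *)
Lemma bin_three_blocks (R : comNzRingType) (q W l d b : nat) :
  [pchar R].-nat q -> [pchar R].-nat W -> (1 < q)%N -> (l < W)%N -> (d < q)%N -> (b <= 1)%N ->
  'C(W - 1 + (q - 2 + 1 * q) * W, l + (d + b * q) * W)%:R
    = (-1) ^+ l * ((-1) ^+ d * d.+1%:R) :> R.
Proof.
move=> pq pW q1 ltl ltd leb; rewrite lucas_pchar //; last by lia.
rewrite lucas_pchar //; last by lia.
rewrite bin_pred_pchar // bin_pred2_pchar //.
by case: b leb => [|[|//]] _; rewrite ?bin0 ?binn mulr1.
Qed.

Lemma two_progression_terms (l s i j M : nat) :
  (l %| s + i)%N -> (l %| s + j)%N -> (i <= M)%N -> (M < j + l)%N -> (j < 2 * l)%N ->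
  i = j \/ (i + l)%N = j.
Proof.
move=> dvdi dvdj lei ltM ltj; have [le_ij|lt_ji] := leqP i j.
  have : (l %| j - i)%N by rewrite -(subnDl s) dvdn_sub.
  by move=> /dvdnP[[|[|k]] jk]; [left; lia | right; lia | nia].
have : (l %| i - j)%N by rewrite -(subnDl s) dvdn_sub.
by move/dvdn_leq; rewrite subn_gt0 => /(_ lt_ji); lia.
Qed.

(* For [N = ell q n + 2 * q ^ n] the progression meets [0, (q - 1) * N] in at most the two
   points [j] and [j - ell q n.+2], whose binomials are [k + 1] and [k] up to sign. *)
Lemma no_lone_term_two_blocks (F : fieldType) (q n r l k : nat) :
  (1 < q)%N -> (0 < n)%N -> [pchar F].-nat q -> no_lone_term F q n.+2 r ->
  (k.+1 < q)%N -> (ell q n <= l < q ^ n)%N ->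
  (ell q n.+2 %| r * (ell q n + 2 * q ^ n) + (l + (k + q) * q ^ n))%N ->
  k.+1%:R != 0 :> F /\ k%:R != 0 :> F.
Proof.
move=> q1 n0 pq S ltk /andP[leL ltl]; set W := (q ^ n)%N in leL ltl *.
set L := ell q n in leL *; set N := (L + 2 * W)%N; set j := (l + _)%N => dvdj.
have W0 : (0 < W)%N by rewrite expn_gt0 ltnW.
have ltLW : (L < W)%N by apply: ell_ltX.
have [q2 qE] : exists q2, q = q2.+2 by exists (q - 2)%N; lia.
have qW : (q * W = q2 * W + 2 * W)%N by rewrite qE; ring.
have kW : (k * W <= q2 * W)%N by rewrite leq_mul2r; apply/orP; right; lia.
have lE : ell q n.+2 = (L + W + q * W)%N by apply: ellSS.
have M_E : ((q - 1) * N = W - 1 + (q - 2 + 1 * q) * W)%N.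
  have := mul_pred_ell q n; rewrite -/L -/W /N mulnDr => ->.
  by have -> : (q - 2 + 1 * q = (q - 1) * 2)%N by [lia]; rewrite mulnA.
have M_E' : ((q - 1) * N = W - 1 + q2 * W + q * W)%N.
  by rewrite M_E mul1n mulnDl qE subSS subSS subn0 addnA.
have pW : [pchar F].-nat W by rewrite pnatX pq.
have jE : j = (l + k * W + q * W)%N by rewrite /j mulnDl addnA.
have j1C : 'C((q - 1) * N, j)%:R = (-1) ^+ l * ((-1) ^+ k * k.+1%:R) :> F.
  have -> : j = (l + (k + 1 * q) * W)%N by rewrite mul1n.
  by rewrite M_E bin_three_blocks //; lia.
have j0E : (0 < k)%N -> exists2 i, (i + ell q n.+2)%N = j
    & 'C((q - 1) * N, i)%:R = (-1) ^+ (l - L) * ((-1) ^+ (k - 1) * k%:R) :> F.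
  move=> k0; exists (l - L + (k - 1 + 0 * q) * W)%N.
    by have := leq_pmull W k0; rewrite jE lE mul0n addn0 mulnBl mul1n; lia.
  by rewrite M_E bin_three_blocks //; [rewrite subn1 prednK | lia | lia].
have ltM : ((q - 1) * N < j + ell q n.+2)%N by rewrite M_E' lE jE; lia.
have ltj : (j < 2 * ell q n.+2)%N by rewrite lE jE; lia.
have lejM : (j <= (q - 1) * N)%N by rewrite M_E' jE; lia.
have ltN : (0 < N < ell q n.+2)%N by apply/andP; split; rewrite ?lE /N; lia.
(* If [k + 1] vanishes, then [k] is -1 and [i] is a lone term; if [k] vanishes, [j] is one. *)
split; apply/negP => /eqP kF.
  have k0 : (0 < k)%N.
    by rewrite lt0n; apply/negP => /eqP k0; move/eqP: kF; rewrite k0 oner_eq0.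
  have [i i_j iC] := j0E k0; suff /eqP : 'C((q - 1) * N, i)%:R = 0 :> F.
    have kN1 : k%:R = -1 :> F by apply/eqP; rewrite -addr_eq0 -mulrSr kF.
    by rewrite iC kN1 !mulf_eq0 oppr_eq0 !signr_eq0 oner_eq0.
  apply: S => //; first by apply: leq_trans lejM; rewrite -i_j leq_addr.
    by rewrite -(dvdn_addl _ (dvdnn (ell q n.+2))) -addnA i_j.
  move=> m lemM dvdm neq_m; have := two_progression_terms _ _ _ _ _ dvdm dvdj lemM ltM ltj.
  case=> [->|/eqP]; first by rewrite j1C kF !mulr0.
  by rewrite -i_j eqn_add2r (negPf neq_m).
suff /eqP : 'C((q - 1) * N, j)%:R = 0 :> F.
  by rewrite j1C mulrSr kF add0r mulr1 mulf_eq0 !signr_eq0.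
apply: S => // m lemM dvdm neq_m.
have := two_progression_terms _ _ _ _ _ dvdm dvdj lemM ltM ltj.
case=> [/eqP|m_j]; first by rewrite (negPf neq_m).
have k0 : (0 < k)%N.
  by rewrite lt0n; apply/negP => /eqP k0; move: m_j; rewrite lE jE k0; lia.
have [i i_j iC] := j0E k0; have -> : m = i by lia.
by rewrite iC kF !mulr0.
Qed.

(** Here [l < ell q n], so subtracting [ell q n.+2] from [j] borrows a block: the coefficients are
    [k + 1] and [k - 1] up to sign, both 1 in this characteristic. The sum is then
    [c ^+ i + c ^+ j]. *)
Lemma hermite_sums_two_blocks (F : fieldType) (q n r l k : nat) (c : F) :
  (1 < q)%N -> (0 < n)%N -> [pchar F].-nat q -> 2%:R = 0 :> F -> k%:R = 0 :> F ->
  hermite_sums F q n.+2 r c -> c != 0 -> (1 < k < q)%N -> (l < ell q n)%N ->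
  (ell q n.+2 %| r * (ell q n + 2 * q ^ n) + (l + (k + q) * q ^ n))%N ->
  c ^+ ell q n.+2 = 1.
Proof.
move=> q1 n0 pq two0 kF H c0 /andP[k2 ltk]; set W := (q ^ n)%N.
set L := ell q n => ltl; set N := (L + 2 * W)%N; set j := (l + _)%N => dvdj.
have W0 : (0 < W)%N by rewrite expn_gt0 ltnW.
have ltLW : (L < W)%N by apply: ell_ltX.
have [q2 qE] : exists q2, q = q2.+2 by exists (q - 2)%N; lia.
have qW : (q * W = q2 * W + 2 * W)%N by rewrite qE; ring.
have kW : (k * W <= q2 * W + W)%N by rewrite -mulSnr leq_mul2r; apply/orP; right; lia.
have k2W : (2 * W <= k * W)%N by rewrite leq_mul2r k2 orbT.
have lE : ell q n.+2 = (L + W + q * W)%N by apply: ellSS.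
have M_E : ((q - 1) * N = W - 1 + (q - 2 + 1 * q) * W)%N.
  have := mul_pred_ell q n; rewrite -/L -/W /N mulnDr => ->.
  by have -> : (q - 2 + 1 * q = (q - 1) * 2)%N by [lia]; rewrite mulnA.
have M_E' : ((q - 1) * N = W - 1 + q2 * W + q * W)%N.
  by rewrite M_E mul1n mulnDl qE subSS subSS subn0 addnA.
have pW : [pchar F].-nat W by rewrite pnatX pq.
have jE : j = (l + k * W + q * W)%N by rewrite /j mulnDl addnA.
have opp1 : -1 = 1 :> F.
  by apply/eqP; rewrite eq_sym -subr_eq0 opprK -mulr2n two0.
have j1C : 'C((q - 1) * N, j)%:R = 1 :> F.
  have -> : j = (l + (k + 1 * q) * W)%N by rewrite mul1n.
  rewrite M_E bin_three_blocks //; last by lia.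
  by rewrite opp1 !expr1n !mul1r mulrSr kF add0r.
have [i i_j iC] : exists2 i, (i + ell q n.+2)%N = j & 'C((q - 1) * N, i)%:R = 1 :> F.
  exists (l + W - L + (k - 2 + 0 * q) * W)%N.
    by rewrite jE lE mul0n addn0 mulnBl; lia.
  rewrite M_E bin_three_blocks //; try lia.
  have -> : (k - 2).+1%:R = 1 :> F.
    rewrite -[RHS]opp1; apply/eqP; rewrite -addr_eq0 -mulrSr -[X in _ == X]kF.
    by apply/eqP; congr (_%:R); lia.
  by rewrite opp1 !expr1n !mulr1.
have ltj : (j < 2 * ell q n.+2)%N by rewrite lE jE; lia.
have ltM : ((q - 1) * N < j + ell q n.+2)%N by rewrite M_E' lE jE; lia.
have lejM : (j <= (q - 1) * N)%N.
  rewrite leqNgt; apply/negP => ltMj; move/eqP: j1C.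
  by rewrite bin_small // eq_sym oner_eq0.
have ltN : (0 < N < ell q n.+2)%N by apply/andP; split; rewrite ?lE /N; lia.
have dvdi : (ell q n.+2 %| r * N + i)%N.
  by rewrite -(dvdn_addl _ (dvdnn (ell q n.+2))) -addnA i_j.
have leiM : (i <= (q - 1) * N)%N by apply: leq_trans lejM; rewrite -i_j leq_addr.
have l0 : (0 < ell q n.+2)%N by apply: ell_gt0.
have neq_ij : i != j by rewrite -i_j -[X in X != _]addn0 eqn_add2l eq_sym -lt0n.
have := H N ltN; rewrite (bigD1 (inord j)) /= inordK ?ltnS //.
rewrite (bigD1 (inord i)) /=; last first.
  rewrite inordK ?ltnS // dvdi; apply: contraNneq neq_ij => /(congr1 val).
  by rewrite /= !inordK ?ltnS // => ->.
rewrite inordK ?ltnS // big1 => [|m /andP[/andP[dvdm neq_mj] neq_mi]]; last first.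
  have lemM : (m <= (q - 1) * N)%N by rewrite -ltnS.
  have := two_progression_terms _ _ _ _ _ dvdm dvdj lemM ltM ltj.
  case=> [m_j|m_j]; first by move: neq_mj; rewrite -m_j inord_val eqxx.
  have m_i : m = i :> nat by lia.
  by move: neq_mi; rewrite -m_i inord_val eqxx.
rewrite j1C iC addr0 !mul1r -i_j exprD -[X in _ + X]mulr1 -mulrDr => /eqP.
by rewrite mulf_eq0 expf_eq0 (negPf c0) andbF /= addr_eq0 opp1 => /eqP.
Qed.

Lemma ell1 q : ell q 1 = 1%N.
Proof. by rewrite ellS ell0 muln0. Qed.

Lemma ell2 q : ell q 2 = (1 + q)%N.
Proof. by rewrite ellS ell1 muln1. Qed.

Lemma ell3 q : ell q 3 = (1 + q + q ^ 2)%N.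
Proof. by rewrite ellS ell2; ring. Qed.

Lemma ell4 q : ell q 4 = (1 + q + q ^ 2 + q ^ 3)%N.
Proof. by rewrite ellS ell3; ring. Qed.

Lemma ell5 q : ell q 5 = (1 + q + q ^ 2 + q ^ 3 + q ^ 4)%N.
Proof. by rewrite ellS ell4; ring. Qed.

(** If [k] were positive, the two-block exponent would make [k] and [k - 1] nonzero in [F]. One of
    them is even, which excludes characteristic 2; otherwise doubling makes [k] vanish. *)
Lemma no_lone_term_small (F : fieldType) (q n k : nat) :
  (1 < q)%N -> (n == 1) || (n == 2)%N -> [pchar F].-nat q -> q%:R = 0 :> F ->
  no_lone_term F q n.+2 (1 + q * (k * ell q n)) -> (2 * k < q)%N -> k = 0%N.
Proof.
move=> q1 n12 pq qF S ltk; apply/eqP; rewrite -leqn0 leqNgt; apply/negP => k0.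
have n0 : (0 < n)%N by case/orP: n12 => /eqP ->.
have [k' kE] : exists k', k = k'.+1 by exists (k - 1)%N; lia.
have [kF kF1] : k%:R != 0 :> F /\ k'%:R != 0 :> F.
  have [l [ltl dvdl]] : exists l, (ell q n <= l < q ^ n)%N /\
      (ell q n.+2 %| (1 + q * (k * ell q n)) * (ell q n + 2 * q ^ n)
         + (l + (k' + q) * q ^ n))%N.
    case/orP: n12 => /eqP ->.
      exists (2 * k)%N; rewrite ell1 expn1 ell3; split; first by lia.
      by apply/dvdnP; exists (1 + 2 * k)%N; rewrite kE; ring.
    exists (k + 2 * k * q)%N; rewrite ell2 ell4; split.
      by apply/andP; split; rewrite kE in ltk *; nia.
    by apply/dvdnP; exists (1 + k * (1 + 2 * q))%N; rewrite kE; ring.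
  rewrite kE; apply: (no_lone_term_two_blocks F q n _ l k' q1 n0 pq S) => //.
  by lia.
have [two0|two0] := eqVneq (2%:R : F) 0.
  have [kodd|keven] := boolP (odd k).
    move: kF1; suff -> : k' = (k'./2 * 2)%N by rewrite natrM two0 mulr0 eqxx.
    by rewrite muln2; move: kodd; rewrite kE /= => /even_halfK ->.
  move: kF; suff -> : k = (k./2 * 2)%N by rewrite natrM two0 mulr0 eqxx.
  by rewrite muln2 even_halfK.
have lt2T : (2 * (k * ell q n) < ell q n.+1)%N.
  by rewrite ellS mulnA ltnS leq_mul2r ltnW ?orbT.
have /eqP := no_lone_term_double F q n.+1 _ q1 pq qF isT lt2T S.
by rewrite !natrM !mulf_eq0 (negPf two0) (negPf kF) natr_ell // oner_eq0.
Qed.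

Lemma permutes_residue_small (F : finFieldType) (q n r : nat) (a : F) :
  (1 < q)%N -> (n == 1) || (n == 2)%N -> [pchar F].-nat q -> q%:R = 0 :> F ->
  #|F| = (q ^ n.+2)%N -> (0 < r)%N -> a != 0 -> permutes_f q r a ->
  (r %% ell q n.+2)%N \in [:: 1; ell q n.+2 - q]%N.
Proof.
move=> q1 n12 pq qF oF r0 a0 perm_f.
have n0 : (0 < n)%N by case/orP: n12 => /eqP ->.
have norm := permutes_norm_neq1 F q n.+2 r a q1 isT oF r0 perm_f.
have H := permutes_hermite F q n.+2 r a q1 oF r0 a0 perm_f.
have S : no_lone_term F q n.+2 r.
  by apply: hermite_no_lone_term H; rewrite invr_eq0.
have [T ltT rT] := no_lone_term_residue F q n.+1 r q1 pq isT S.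
have ST := no_lone_term_modn _ _ _ _ _ rT S.
(* In degree 4, restriction to degree 2 gives [r = 1] modulo [ell q 2], and [q] is prime to
   [ell q 2]. *)
have [k Tk] : exists k, T = (k * ell q n)%N.
  case/orP: (n12) => /eqP n_eq; first by exists T; rewrite n_eq ell1 muln1.
  rewrite n_eq in S rT *; have S2 : no_lone_term F q 2 r.
    by apply: (no_lone_term_dvd F q 2 2).
  have [U] := no_lone_term_residue F q 1 r q1 pq isT S2.
  rewrite ell1 ltnS leqn0 => /eqP ->; rewrite muln0 addn0 => r1.
  have l4 : ell q 4 = (ell q 2 * (1 + q ^ 2))%N by rewrite ell4 ell2; ring.
  have : (1 + q * T = 1 %[mod ell q 2])%N.
    by rewrite -r1; apply/eqP; rewrite -[X in X == _](modn_dvdm _ (dvdn_mulr (1 + q ^ 2) (dvdnn (ell q 2)))) -l4 -rT l4 modn_dvdm // dvdn_mulr.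
  move/eqP; rewrite -[X in _ == X %[mod _]]addn0 eqn_modDl mod0n => dvdT.
  have : (ell q 2 %| T)%N.
    rewrite -(@Gauss_dvdr _ q) //; rewrite ell2 /coprime gcdnC gcdnDr //.
    by rewrite gcdn1.
  by move/dvdnP.
have L0 := ell_gt0 q n n0.
have lekq : (k <= q)%N.
  by move: ltT; rewrite Tk ellS ltnS leq_mul2r (gtn_eqF L0).
have lq : (1 + q * (q * ell q n) = ell q n.+2 - q)%N by rewrite !ellS; lia.
have l1 : (q < ell q n.+2)%N by rewrite !ellS; nia.
rewrite rT Tk; have [->|k0] := posnP k.
  by rewrite mul0n muln0 addn0 modn_small ?inE // (leq_ltn_trans _ l1) // ltnW.
have [->|neq_kq] := eqVneq k q.
  by rewrite lq modn_small ?inE ?eqxx ?orbT //; lia.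
have ltkq : (k < q)%N by rewrite ltn_neqAle neq_kq.
(* The flip exchanges [k] and [q - k], so only the fixed point [2 * k = q] remains. *)
exfalso; case: (ltngtP (2 * k) q) => [lt2k|lt2k|eq2k].
- by rewrite Tk in ST; have := no_lone_term_small F q n k q1 n12 pq qF ST lt2k; lia.
- suff : (q - k = 0)%N by lia.
  apply: (no_lone_term_small F q n) => //; last by lia.
  apply: no_lone_term_flip ST; first by lia.
  by rewrite Tk -mulnDl subnKC // addn1 ellS.
have two0 : 2%:R = 0 :> F.
  have : [pchar F].-nat 2 by apply: pnat_dvd pq; rewrite -eq2k dvdn_mulr.
  by rewrite pnatE // inE /= => /eqP.
have opp x : - x = x :> F.
  by apply/eqP; rewrite eq_sym -subr_eq0 opprK -mulr2n -mulr_natl two0 mul0r.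
(* If [k = 1] then [q = 2] and [ell q n.+2 = #|F| - 1], so every nonzero [a] violates [norm].
   Otherwise [k] vanishes in [F] and the two-term sum gives norm 1. *)
have [k1|k1] := leqP k 1.
  have q2 : q = 2%N by lia.
  have /eqP[] := norm; apply: (mulfI a0); rewrite opp -exprS mulr1.
  have -> : (ell q n.+2).+1 = #|F|; last exact: expf_card.
  rewrite oF -[ell q n.+2]mul1n; have -> : 1%N = (q - 1)%N by rewrite q2.
  by rewrite mul_pred_ell subn1 prednK // expn_gt0 ltnW.
have kF : k%:R = 0 :> F.
  have : [pchar F].-nat (pdiv k).
    by apply: pnat_dvd pq; rewrite -eq2k dvdn_mull // pdiv_dvd.
  rewrite pnatE ?pdiv_prime // inE => /andP[_ /eqP pk0].
  by rewrite -(divnK (pdiv_dvd k)) natrM pk0 mulr0.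
have [l [ltl dvdl]] : exists l, (l < ell q n)%N /\
    (ell q n.+2 %| r * (ell q n + 2 * q ^ n) + (l + (k + q) * q ^ n))%N.
  case/orP: n12 => /eqP n_eq; rewrite n_eq in rT Tk *.
    exists 0%N; rewrite ell1; split=> //; rewrite (dvdn_modMDl _ _ _ _ _ rT).
    by apply/dvdnP; exists (1 + 2 * k)%N; rewrite Tk ell1 ell3 -eq2k; ring.
  exists k; rewrite ell2; split; first by lia.
  rewrite (dvdn_modMDl _ _ _ _ _ rT).
  by apply/dvdnP; exists (1 + k * (1 + 2 * q))%N; rewrite Tk ell2 ell4 -eq2k; ring.
have := hermite_sums_two_blocks F q n r l k a^-1 q1 n0 pq two0 kF H.
rewrite invr_eq0 a0 k1 ltkq => /(_ isT isT ltl dvdl)/eqP.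
by rewrite exprVn invr_eq1 -{1}[a]opp (negPf norm).
Qed.

(** * Degrees 5 and 6 *)

Lemma bin_pchar_neq0 (F : fieldType) (p n i : nat) :
  p \in [pchar F] -> (i <= n)%N -> (n < p)%N -> 'C(n, i)%:R != 0 :> F.
Proof.
move=> pF lein ltn; have : n`!%:R != 0 :> F.
  elim: n ltn {lein} => [|n IHn] ltn; first by rewrite fact0 oner_eq0.
  by rewrite factS natrM mulf_neq0 ?IHn 1?ltnW // -(dvdn_pcharf pF) gtnNdvd.
by rewrite -(bin_fact lein) natrM mulf_eq0 negb_or => /andP[].
Qed.

Lemma bin_digits_neq0 (F : fieldType) (p a b c d i j k l : nat) :
  p \in [pchar F] -> (i <= a < p)%N -> (j <= b < p)%N -> (k <= c < p)%N -> (l <= d < p)%N ->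
  'C(a + (b + (c + d * p) * p) * p, i + (j + (k + l * p) * p) * p)%:R != 0 :> F.
Proof.
move=> pF /andP[ia ap] /andP[jb bp] /andP[kc cp] /andP[ld dp].
have pp : [pchar F].-nat p by rewrite pnatE ?(pcharf_prime pF).
rewrite !lucas_pchar ?mulf_neq0 ?(bin_pchar_neq0 _ p) //.
- exact: leq_ltn_trans kc cp.
- exact: leq_ltn_trans jb bp.
exact: leq_ltn_trans ia ap.
Qed.

(* With [q = 2 * h + 1] and [N] below, [(q - 1) * N] has base-[q] digits [h, 2 h, h, 2 h], low
   digit first. The only term is [j], with digits [h - m, h + m, h, h - 1 - m] if
   [k = 2 m + 1] and [h - m, h + m + 1, 0, 2 h - m] if [k = 2 m + 2]. *)
Lemma no_lone_term_five_low (F : fieldType) (q k : nat) :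
  q \in [pchar F] -> odd q -> (0 < k < q)%N -> ~ no_lone_term F q 5 (1 + q * (q * k)).
Proof.
move=> qF qodd /andP[k0 ltk] S; pose h := q./2.
have qE : q = (2 * h + 1)%N by rewrite -[LHS]odd_double_half qodd -/h mul2n addnC.
pose N := (2 * (h + 1) ^ 2 + q ^ 3)%N.
have M_E : ((q - 1) * N = h + (2 * h + (h + 2 * h * q) * q) * q)%N.
  by have -> : (q - 1 = 2 * h)%N by [lia]; rewrite /N qE; ring.
have q1 : (1 < q)%N by apply/prime_gt1/(pcharf_prime qF).
have N4 : (N < ell q 4)%N.
  have : (2 * (h + 1) * (h + 1) <= (q + 1) * q)%N by apply: leq_mul; lia.
  by rewrite ell4 /N -mulnA !mulnn mulnDl mul1n mulnn; lia.
have ltN : (0 < N < ell q 5)%N.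
  rewrite (leq_trans N4) ?leq_ell // andbT.
  by rewrite /N addn_gt0 [(0 < q ^ 3)%N]expn_gt0 (ltnW q1) orbT.
have ltM : ((q - 1) * N < ell q 5)%N.
  apply: leq_ltn_trans (_ : q ^ 4 - 1 < _)%N.
    by rewrite -mul_pred_ell leq_mul2l ltnW ?orbT.
  by rewrite ell5; lia.
(* The row is shorter than [ell q 5], so any term is alone; digits bounded by those of the row make
   its binomial nonzero. *)
have key a b c d : (a <= h)%N -> (b <= 2 * h)%N -> (c <= h)%N -> (d <= 2 * h)%N ->
    (ell q 5 %| (1 + q * (q * k)) * N + (a + (b + (c + d * q) * q) * q))%N -> False.
  move=> lea leb lec led dvd.
  set j := (a + _)%N in dvd *; have C0 : 'C((q - 1) * N, j)%:R != 0 :> F.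
    by rewrite M_E; apply: bin_digits_neq0; lia.
  have lejM : (j <= (q - 1) * N)%N.
    rewrite leqNgt; apply/negP => ltMj; move/eqP: C0.
    by rewrite bin_small.
  move/eqP: C0; apply; apply: (lone_term_eq0 F q 5 _ N j S) => //.
    by apply: leq_trans ltM _; rewrite leq_addl.
  exact: leq_ltn_trans ltM.
have [kodd|keven] := boolP (odd k).
  pose m := k./2; have kE : k = (2 * m + 1)%N by rewrite -[LHS]odd_double_half kodd mul2n addnC.
  (* Writing [h = m + s + 1] expresses the digits of [j] without subtraction. *)
  have [s hE] : exists s, h = (m + s + 1)%N by exists (h - m - 1)%N; lia.
  apply: (key (s + 1) (2 * m + s + 1) (m + s + 1) s)%N; try lia.
  apply/dvdnP; exists (m * (4 * h + 1) + q)%N.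
  by rewrite ell5 /N kE qE hE; ring.
have [m kE] : exists m, k = (2 * m + 2)%N.
  exists (k./2 - 1)%N; rewrite -[LHS]even_halfK // -mul2n.
  by have : (0 < k./2)%N by [rewrite half_gt0; case: (k) k0 keven => [|[]]]; lia.
have [s hE] : exists s, h = (m + s + 1)%N by exists (h - m - 1)%N; lia.
apply: (key (s + 1) (2 * m + s + 2) 0 (m + 2 * s + 2))%N; try lia.
apply/dvdnP; exists (m * (4 * h + 1) + 2 * q)%N.
by rewrite ell5 /N kE qE hE; ring.
Qed.

(** Write [T = q * U]. The range [0 < U < q] is already excluded, and for [U > q] the repunit
    [ell q 3] has a term at [U * (1 + q) - ell q 3], below [q ^ 3]. *)
Lemma no_lone_term_five (F : fieldType) (q T : nat) :
  q \in [pchar F] -> odd q -> (2 * T < ell q 4)%N ->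
  no_lone_term F q 5 (1 + q * T) -> T = 0%N \/ T = (q ^ 2)%N.
Proof.
move=> qF qodd lt2T S; have q_pr := pcharf_prime qF; have q1 := prime_gt1 q_pr.
have pq : [pchar F].-nat q by rewrite pnatE.
have qF0 : q%:R = 0 :> F by apply/eqP; rewrite -(dvdn_pcharf qF).
have two0 : 2%:R != 0 :> F.
  rewrite -(dvdn_pcharf qF) dvdn_prime2 //; apply: contraTneq qodd => ->.
  by [].
have ltT : (T < ell q 4)%N by lia.
have /eqP := no_lone_term_odd F q 4 T q1 pq qF0 two0 isT ltT S.
rewrite -(dvdn_pcharf qF) => /dvdnP[U]; rewrite mulnC => TU; rewrite TU in S lt2T *.
have [U0|U0] := posnP U; first by left; rewrite U0 muln0.
have [ltUq|leqU] := ltnP U q.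
  by have := no_lone_term_five_low F q U qF qodd; rewrite U0 ltUq => /(_ isT S).
right; have [->|neqU] := eqVneq U q; first by rewrite mulnn.
have leqU1 : (q.+1 <= U)%N by rewrite ltn_neqAle eq_sym neqU.
have ltU : (U <= q ^ 2)%N.
  rewrite leqNgt; apply/negP => ltU; move: lt2T; rewrite ell4.
  have : (q * (q ^ 2 + 1) <= q * U)%N by rewrite leq_mul2l addn1 ltU orbT.
  have : (q ^ 2 <= q ^ 3)%N by rewrite leq_pexp2l // ltnW.
  by rewrite mulnDr muln1 -expnS; lia.
pose j := (U * (1 + q) - ell q 3)%N.
have leU : (ell q 3 <= U * (1 + q))%N.
  apply: leq_trans (leq_mul leqU1 (leqnn _)).
  by rewrite ell3 -mulnn; lia.
have ltj : (j < q ^ 3)%N.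
  have : (U * (1 + q) <= q ^ 2 * (1 + q))%N by rewrite leq_mul2r ltU.
  by rewrite /j ell3 [(q ^ 2 * (1 + q))%N]mulnDr muln1 -expnSr; lia.
have /negP[] := no_lone_term_repunit F q 5 3 _ j q1 pq S isT ltj.
apply/dvdnP; exists U; rewrite /j; apply/eqP.
rewrite -(eqn_add2r (ell q 3)) -addnA subnK //; apply/eqP; rewrite ell3 ell5; ring.
Qed.

(** [T] is divisible by [q] and, via degree 2, by [ell q 2]; via degree 3 it is 0 or [q] modulo
    [ell q 3]. These three moduli are pairwise coprime with product above [ell q 5], so [T = 0] in
    the first case and [ell q 5 - 1 - T = 0] in the second. *)
Lemma no_lone_term_six (F : fieldType) (q r : nat) :
  q \in [pchar F] -> odd q -> no_lone_term F q 6 r ->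
  (r %% ell q 6)%N \in [:: 1; ell q 6 - q]%N.
Proof.
move=> qF qodd S; have q_pr := pcharf_prime qF; have q1 := prime_gt1 q_pr.
have pq : [pchar F].-nat q by rewrite pnatE.
have qF0 : q%:R = 0 :> F by apply/eqP; rewrite -(dvdn_pcharf qF).
have two0 : 2%:R != 0 :> F.
  rewrite -(dvdn_pcharf qF) dvdn_prime2 //; apply: contraTneq qodd => ->.
  by [].
have dvd_q e U : (0 < e)%N -> (U < ell q e)%N ->
    no_lone_term F q e.+1 (1 + q * U) -> (q %| U)%N.
  move=> e0 ltU /(no_lone_term_odd F q e U q1 pq qF0 two0 e0 ltU)/eqP.
  by rewrite -(dvdn_pcharf qF).
have cop e : (0 < e)%N -> coprime (ell q e) q.
  by case: e => // e _; rewrite ellS /coprime gcdnC addnC mulnC gcdnMDl gcdn1.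
have restrict e d T U : (0 < e)%N -> (0 < d)%N -> r = 1 + q * T %[mod ell q (e * d)] ->
    r = 1 + q * U %[mod ell q e] -> T = U %[mod ell q e].
  move=> e0 d0 rT rU; have dvdl : (ell q e %| ell q (e * d))%N by rewrite ellM // dvdn_mulr.
  have : (1 + q * T = 1 + q * U %[mod ell q e])%N.
    by rewrite -rU -(modn_dvdm _ dvdl) -rT modn_dvdm.
  move/eqP; rewrite eqn_modDl => qTU; apply/eqP.
  case/orP: (leq_total U T) => le.
    by move: qTU; rewrite !eqn_mod_dvd ?leq_mul2l ?le ?orbT // -mulnBr Gauss_dvdr // cop.
  rewrite eq_sym; move: qTU; rewrite eq_sym.
  by rewrite !eqn_mod_dvd ?leq_mul2l ?le ?orbT // -mulnBr Gauss_dvdr // cop.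
have [T ltT rT] := no_lone_term_residue F q 5 r q1 pq isT S.
have ST := no_lone_term_modn _ _ _ _ _ rT S.
have qT := dvd_q 5%N T isT ltT ST.
have T2 : (ell q 2 %| T)%N.
  have S2 : no_lone_term F q 2 r by apply: (no_lone_term_dvd F q 2 3).
  have [U + rU] := no_lone_term_residue F q 1 r q1 pq isT S2.
  rewrite ell1 ltnS leqn0 => /eqP U0; rewrite U0 in rU.
  by have := restrict 2%N 3%N T 0%N isT isT rT rU; rewrite mod0n => /eqP.
have [U [ltU qU TU]] : exists U, [/\ (U < ell q 2)%N, (q %| U)%N & T = U %[mod ell q 3]].
  have S3 : no_lone_term F q 3 r by apply: (no_lone_term_dvd F q 3 2).
  have [U ltU rU] := no_lone_term_residue F q 2 r q1 pq isT S3.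
  exists U; split=> //; last exact: restrict 3%N 2%N T U isT isT rT rU.
  exact: dvd_q 2%N U isT ltU (no_lone_term_modn _ _ _ _ _ rU S3).
have small V : (V < ell q 5)%N -> (q %| V)%N -> (ell q 2 %| V)%N -> (ell q 3 %| V)%N -> V = 0%N.
  move=> ltV qV V2 V3; have cop23 : coprime (ell q 2) (ell q 3).
    rewrite ell2 ell3; have -> : (1 + q + q ^ 2 = q * (1 + q) + 1)%N by ring.
    by rewrite /coprime gcdnMDl gcdn1.
  have V6 : (q * (ell q 2 * ell q 3) %| V)%N.
    by rewrite Gauss_dvd ?qV ?Gauss_dvd ?V2 // coprimeMr ![coprime q _]coprime_sym !cop.
  apply/eqP; rewrite -leqn0 leqNgt; apply/negP => V0.
  have := leq_trans (dvdn_leq V0 V6) (ltnW ltV).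
  have -> : (q * (ell q 2 * ell q 3) = q + 2 * q ^ 2 + 2 * q ^ 3 + q ^ 4)%N.
    by rewrite ell2 ell3; ring.
  have : (2 ^ 2 <= q ^ 2)%N by rewrite leq_exp2r.
  by rewrite ell5; clear; lia.
have lq : (1 + q * (ell q 5 - 1) = ell q 6 - q)%N.
  by rewrite (ellS q 5) mulnBr muln1 addnBA // leq_pmulr // ell_gt0.
have l6 : (q < ell q 6)%N by rewrite (ellS q 5) add1n ltnS leq_pmulr // ell_gt0.
have U0q : U = 0%N \/ U = q.
  move: ltU; rewrite ell2 add1n ltnS; case/dvdnP: qU => [[|[|k]] ->]; [by left | by right; rewrite mul1n |].
  by rewrite leqNgt ltn_Pmull // ltnW.
rewrite rT !inE; case: U0q => Uq.
  have -> : T = 0%N.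
    by apply: small => //; rewrite /dvdn TU Uq mod0n.
  by rewrite muln0 addn0 modn_small ?eqxx // (leq_ltn_trans _ l6) // ltnW.
have T0 : (ell q 5 - 1 - T = 0)%N.
  have l5 : (ell q 5 - 1 = q * ell q 4)%N by rewrite ellS add1n subn1.
  have leT : (T <= q * ell q 4)%N by rewrite -l5 -ltnS subn1 prednK // ell_gt0.
  apply: small; rewrite ?l5.
  - by rewrite -l5 -subnDA ltn_subrL ell_gt0.
  - by rewrite dvdn_subr // dvdn_mulr.
  - rewrite dvdn_subr // dvdn_mull //.
    by rewrite (ellM q 2 2) // dvdn_mulr.
  rewrite -(eqn_mod_dvd _ leT) TU Uq ell4.
  have -> : (q * (1 + q + q ^ 2 + q ^ 3) = q * q * ell q 3 + q)%N by rewrite ell3; ring.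
  by rewrite modnMDl.
have -> : T = (ell q 5 - 1)%N.
  by apply/eqP; rewrite eqn_leq -[X in _ && X]subn_eq0 T0 eqxx andbT -ltnS subn1 prednK // ell_gt0.
by rewrite lq modn_small ?eqxx ?orbT // ltn_subrL (ltnW q1) ell_gt0.
Qed.

(** In the lower half [T] is 0 or [q ^ 2]; flipping these gives [ell q 5 - q] and
    [q ^ 4 + q ^ 2 + 1]. *)
Lemma no_lone_term_five_residue (F : fieldType) (q r : nat) :
  q \in [pchar F] -> odd q -> no_lone_term F q 5 r ->
  (r %% ell q 5)%N \in [:: 1; ell q 5 - q; q ^ 3 + 1; q ^ 4 + q ^ 2 + 1]%N.
Proof.
move=> qF qodd S; have q1 := prime_gt1 (pcharf_prime qF).
have pq : [pchar F].-nat q by rewrite pnatE ?(pcharf_prime qF).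
have [T ltT rT] := no_lone_term_residue F q 4 r q1 pq isT S.
have ST := no_lone_term_modn _ _ _ _ _ rT S.
have -> : (r %% ell q 5 = 1 + q * T)%N.
  by rewrite rT modn_small // ellS ltn_add2l ltn_pmul2l // ltnW.
have [lt2T|le2T] := ltnP (2 * T) (ell q 4).
  by case: (no_lone_term_five F q T qF qodd lt2T ST) => ->; rewrite ?muln0 -?expnS addnC !inE eqxx ?orbT.
have [U TU] : exists U, (T + U + 1 = ell q 4)%N by exists (ell q 4 - 1 - T)%N; lia.
have SU := no_lone_term_flip _ _ _ _ _ (ltnW q1) TU ST.
have lt2U : (2 * U < ell q 4)%N by lia.
have l4 := ell4 q; have T_E : (T = q + q ^ 2 + q ^ 3 - U)%N by lia.
have l5 : (ell q 5 - q = 1 + q * (q + q ^ 2 + q ^ 3))%N.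
  have -> : ell q 5 = (1 + q * (q + q ^ 2 + q ^ 3) + q)%N by rewrite ell5; ring.
  by rewrite addnK.
case: (no_lone_term_five F q U qF qodd lt2U SU) => UE.
  by rewrite T_E UE subn0 l5 !inE eqxx orbT.
have -> : (1 + q * T = q ^ 4 + q ^ 2 + 1)%N; last by rewrite !inE eqxx !orbT.
by rewrite T_E UE addnAC addnK; ring.
Qed.

(** * Inverses of the listed residues, and the equivalences *)

Lemma permutes_iff (F : finFieldType) (q e r : nat) (a : F) (s : seq nat) :
  (1 < q)%N -> (0 < e)%N -> [pchar F].-nat q -> #|F| = (q ^ e)%N -> (0 < r)%N ->
  (permutes_f q r a -> (r %% ell q e)%N \in s) ->
  {in s, forall t, exists2 m, (0 < m)%N & t * ell q m = 1 %[mod ell q e]} ->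
  permutes_f q r a <->
    [/\ (- a) ^+ ell q e != 1, coprime r (q - 1) & (r %% ell q e)%N \in s].
Proof.
move=> q1 e0 pq oF r0 res inv; split=> [perm_f | [norm cop]].
  split; last exact: res.
    exact: permutes_norm_neq1 q1 e0 oF r0 perm_f.
  exact: permutes_coprime q1 e0 oF perm_f.
move=> /inv[m m0]; rewrite modnMml.
exact: (inverse_ell_permutes F q e r m a q1 e0 oF pq r0 norm cop m0).
Qed.

Lemma inverse_ell1 q e : 1 * ell q 1 = 1 %[mod ell q e].
Proof. by rewrite ell1. Qed.

(** Modulo [ell q e.+1], the product is [- q * ell q e = 1 - ell q e.+1]. *)
Lemma inverse_ell_sub q e : (0 < e)%N ->
  (ell q e.+1 - q) * ell q e = 1 %[mod ell q e.+1].
Proof.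
move=> e0; have l0 := ell_gt0 q e e0.
have -> : ((ell q e.+1 - q) * ell q e = (ell q e - 1) * ell q e.+1 + 1)%N.
  have lE : ell q e.+1 = (1 + q * ell q e)%N by apply: ellS.
  have leq : (q <= ell q e.+1)%N by rewrite lE add1n leqW // leq_pmulr.
  have := leq_pmull (ell q e.+1) l0.
  by rewrite !mulnBl mul1n [(ell q e * _)%N]mulnC {1 3}lE; lia.
by rewrite modnMDl.
Qed.

Theorem theorem1p3 (F : finFieldType) (q e r : nat) (a : F) :
  prime_power q -> #|F| = (q ^ e)%N -> (2 <= e <= 6)%N -> (0 < r)%N -> a != 0 ->
  [/\ (e \in [:: 2; 3; 4]%N ->
        (permutes_f q r a <->
          [/\ (- a) ^+ ell q e != 1, coprime r (q - 1)
            & (r %% ell q e)%N \in [:: 1; ell q e - q]%N])),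
      (e = 5%N -> prime q -> odd q ->
        (permutes_f q r a <->
          [/\ (- a) ^+ ell q e != 1, coprime r (q - 1)
            & (r %% ell q e)%N \in [:: 1; ell q e - q; q ^ 3 + 1; q ^ 4 + q ^ 2 + 1]%N]))
    & (e = 6%N -> prime q -> odd q ->
        (permutes_f q r a <->
          [/\ (- a) ^+ ell q e != 1, coprime r (q - 1)
            & (r %% ell q e)%N \in [:: 1; ell q e - q]%N]))].
Proof.
move=> [p [k [p_pr [k0 q_pk]]]] oF /andP[e2 _] r0 a0.
have q1 : (1 < q)%N by rewrite q_pk -(expn0 p) ltn_exp2l ?prime_gt1.
have e0 : (0 < e)%N by apply: ltnW.
have pF : p \in [pchar F] by apply: (card_finPcharP (n := (k * e)%N)); rewrite // oF q_pk expnM.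
have pq : [pchar F].-nat q by rewrite q_pk pnatX pnatE // pF.
have qF0 : q%:R = 0 :> F.
  by rewrite q_pk natrX (pcharf0 pF) expr0n gtn_eqF.
have S : permutes_f q r a -> no_lone_term F q e r.
  move=> perm_f; apply: (hermite_no_lone_term F q e r a^-1); first by rewrite invr_eq0.
  exact: permutes_hermite.
have inv2 : {in [:: 1; ell q e - q]%N,
    forall t, exists2 m, (0 < m)%N & t * ell q m = 1 %[mod ell q e]}.
  move=> t; rewrite !inE => /orP[] /eqP ->; first by exists 1%N => //; apply: inverse_ell1.
  case: (e) e2 => [|[|n]] // _; exists n.+1 => //.
  exact: inverse_ell_sub.
split.
- move=> e_small; apply: permutes_iff => // perm_f.
  case: (e) e_small oF (S perm_f) => [|[|[|[|[|n]]]]] // _ oF' S'.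
  (* In degree 2 both listed residues are 1, and [T < ell q 1] leaves only [T = 0]. *)
  + have [T + ->] := no_lone_term_residue F q 1 r q1 pq isT S'.
    rewrite ell1 ltnS leqn0 => /eqP ->; rewrite muln0 addn0 ell2.
    by rewrite modn_small ?inE // add1n ltnS ltnW.
  + exact: permutes_residue_small perm_f.
  exact: permutes_residue_small perm_f.
- move=> e5 q_pr q_odd; have qF : q \in [pchar F] by apply: card_finPcharP oF q_pr.
  apply: permutes_iff => // [perm_f|t]; rewrite e5 in S inv2 *.
    exact: no_lone_term_five_residue (S perm_f).
  rewrite !inE !orbA -orbA => /orP[t2|/orP[] /eqP ->].
  + by apply: inv2; rewrite !inE.
  (* The two extra residues have inverses [ell q 3] and [ell q 2], each product being
     [q * ell q 5 + 1]. *)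
  + exists 3%N => //; have -> : ((q ^ 3 + 1) * ell q 3 = q * ell q 5 + 1)%N.
      by rewrite ell3 ell5; ring.
    by rewrite modnMDl.
  exists 2%N => //; have -> : ((q ^ 4 + q ^ 2 + 1) * ell q 2 = q * ell q 5 + 1)%N.
    by rewrite ell2 ell5; ring.
  by rewrite modnMDl.
move=> e6 q_pr q_odd; have qF : q \in [pchar F] by apply: card_finPcharP oF q_pr.
apply: permutes_iff => // perm_f; rewrite e6 in S *.
exact: no_lone_term_six (S perm_f).
Qed.
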